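(* Let $G$ be a group, let $A=\bigoplus_{g\in G}A_g$ be a finite dimensional $G$-graded algebra over a field $k$, and let $\sigma\in G$. The following assertions are equivalent. (i) $A$ is $\sigma$-graded Frobenius. (ii) There exists a non-degenerate associative bilinear form $B:A\times A\to k$ such that $B(r_\tau,r_\mu)=0$ for any $r_\tau\in A_\tau$ and $r_\mu\in A_\mu$ with $\tau\mu\neq\sigma$. (iii) There exists a hyperplane $\mathcal{H}$ in $A$ such that $A_\tau\subseteq\mathcal{H}$ for any $\tau\neq\sigma$, and $\mathcal{H}$ does not contain non-zero graded left ideals.
   Context: A hyperplane is a linear subspace of codimension 1. A bilinear form $B$ is associative if $B(xy,z)=B(x,yz)$ for all $x,y,z\in A$. $A-gr$ denotes the category of $G$-graded left $A$-modules (with degree-preserving $A$-linear maps). For $M\in A-gr$ and $\sigma\in G$, the suspension $M(\sigma)$ is $M$ as an $A$-module with grading $M(\sigma)_g=M_{g\sigma}$. The dual space $A^*=\mathrm{Hom}_k(A,k)$ is a graded left $A$-module with $(af)(x)=f(xa)$ and grading $(A^* )_g=\{f\in A^* \mid f(A_h)=0 \text{ for any } h\neq g^{-1}\}$. $A$ is called $\sigma$-graded Frobenius if $A(\sigma)\simeq A^*$ in $A-gr$. *)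

(* Defs.v *)
From HB Require Import structures.
From mathcomp Require Import all_boot all_order all_algebra all_field.
Set Implicit Arguments.
Unset Strict Implicit.
Unset Printing Implicit Defensive.
Import GRing.Theory.
Local Open Scope ring_scope.

(* M is the internal direct sum of the additive subgroups V i.  The index set
   may be infinite, so elements are sums over duplicate-free sequences. *)
Record is_direct_sum (I : eqType) (M : zmodType) (V : I -> M -> Prop) : Prop :=
  IsDirectSum {
    dsum_0 : forall i, V i 0;
    dsum_B : forall i x y, V i x -> V i y -> V i (x - y);
    dsum_gen : forall x, exists (s : seq I) (f : I -> M),
      [/\ uniq s, forall i, V i (f i) & x = \sum_(i <- s) f i];
    dsum_free : forall (s : seq I) (f : I -> M), uniq s ->
      (forall i, V i (f i)) -> \sum_(i <- s) f i = 0 ->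
      forall i, i \in s -> f i = 0 }.

Section Dual.
Variables (k : fieldType) (A : falgType k).

(* An alias, since 'Hom(A, k^o) already carries a k-module structure. *)
Definition dual := 'Hom(A, k^o).
HB.instance Definition _ := GRing.Zmodule.copy dual 'Hom(A, k^o).

Definition dual_eval (f : dual) : A -> k := fun x => (f : 'Hom(A, k^o)) x.

Definition dual_scale (a : A) (f : dual) : dual := (f \o amulr a)%VF.

Lemma dual_scaleE a f x : dual_eval (dual_scale a f) x = dual_eval f (x * a).
Proof. by rewrite /dual_eval /dual_scale comp_lfunE lfunE. Qed.

Lemma dual_eqP (f g : dual) : dual_eval f =1 dual_eval g -> f = g.
Proof. by move=> fg; apply/lfunP. Qed.

Lemma dual_evalD (f g : dual) x :
  dual_eval (f + g) x = dual_eval f x + dual_eval g x.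
Proof. exact: (@add_lfunE _ _ _ (f : 'Hom(A, k^o)) g). Qed.

Lemma dual_eval0 x : dual_eval 0 x = 0.
Proof. by apply: (addIr (dual_eval 0 x)); rewrite -dual_evalD !add0r. Qed.

Lemma dual_evalB (f g : dual) x :
  dual_eval (f - g) x = dual_eval f x - dual_eval g x.
Proof.
by apply/eqP; rewrite eq_sym subr_eq -dual_evalD subrK.
Qed.

Lemma dual_eval_sum (I : Type) (r : seq I) (f : I -> dual) x :
  dual_eval (\sum_(i <- r) f i) x = \sum_(i <- r) dual_eval (f i) x.
Proof.
elim: r => [|i r IH]; first by rewrite !big_nil dual_eval0.
by rewrite !big_cons dual_evalD IH.
Qed.

Lemma dual_eval_sumr (I : Type) (r : seq I) (f : dual) (x : I -> A) :
  dual_eval f (\sum_(i <- r) x i) = \sum_(i <- r) dual_eval f (x i).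
Proof. exact: (linear_sum (f : 'Hom(A, k^o))). Qed.

Lemma dual_evalDr (f : dual) x y :
  dual_eval f (x + y) = dual_eval f x + dual_eval f y.
Proof. exact: (linearD (f : 'Hom(A, k^o))). Qed.

Fact dual_scaleA a b f : dual_scale a (dual_scale b f) = dual_scale (a * b) f.
Proof. by apply: dual_eqP => x; rewrite !dual_scaleE mulrA. Qed.
Fact dual_scale1 : left_id 1 dual_scale.
Proof. by move=> f; apply: dual_eqP => x; rewrite dual_scaleE mulr1. Qed.
Fact dual_scaleDr : right_distributive dual_scale +%R.
Proof.
by move=> a f g; apply: dual_eqP => x; rewrite dual_evalD !dual_scaleE dual_evalD.
Qed.
Fact dual_scaleDl f : {morph dual_scale^~ f : a b / a + b}.
Proof.
move=> a b; apply: dual_eqP => x.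
by rewrite dual_evalD !dual_scaleE mulrDr dual_evalDr.
Qed.
HB.instance Definition _ := GRing.Zmodule_isLmodule.Build A dual
  dual_scaleA dual_scale1 dual_scaleDr dual_scaleDl.

End Dual.

Section Graded.
Variables (G : groupType) (k : fieldType) (A : falgType k).
Variable Ag : G -> {vspace A}.

(* 1 \in Ag 1 is a consequence of these two axioms. *)
Definition algebra_grading : Prop :=
  is_direct_sum (fun g (x : A) => x \in Ag g) /\
  forall g h : G, (Ag g * Ag h <= Ag (g * h)%g)%VS.

Record grmodType := GrModule {
  gm_sort :> lmodType A;
  gm_comp : G -> gm_sort -> Prop;
  gm_dsum : is_direct_sum gm_comp;
  gm_act : forall (g h : G) (a : A) (x : gm_sort),
    a \in Ag g -> gm_comp h x -> gm_comp (g * h)%g (a *: x) }.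

Definition degree_preserving (M N : grmodType) (f : M -> N) : Prop :=
  forall (g : G) (x : M), gm_comp g x -> gm_comp g (f x).

Definition gr_isomorphic (M N : grmodType) : Prop :=
  exists (f : {linear M -> N}) (f' : {linear N -> M}),
    [/\ degree_preserving f, degree_preserving f', cancel f f' & cancel f' f].

Section Suspension.
Variables (M : grmodType) (s : G).

Let comp (g : G) (x : M) : Prop := gm_comp (g * s)%g x.

Fact suspension_dsum : is_direct_sum comp.
Proof.
have [V0 VB Vg Vf] := gm_dsum M; split=> [i|i x y|x|r f ur fV f0 i ir].
- exact: V0.
- exact: VB.
- have [r [f [ur fV ->]]] := Vg x.
  exists [seq (g * s^-1)%g | g <- r], (fun g => f (g * s)%g); split.
  + by rewrite map_inj_uniq //; exact: mulIg.
  + by move=> i; exact: fV.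
  + by rewrite big_map; apply: eq_bigr => i _; rewrite mulgVK.
- have := Vf [seq (g * s)%g | g <- r] (fun g => f (g * s^-1)%g).
  rewrite map_inj_uniq; last exact: mulIg.
  move=> /(_ ur) H; rewrite -(mulgK s i); apply: H; last exact: map_f.
  + by move=> j; rewrite -{1}[j](mulgVK s); exact: fV.
  + by rewrite big_map -[RHS]f0; apply: eq_bigr => j _; rewrite mulgK.
Qed.

Fact suspension_act (g h : G) (a : A) (x : M) :
  a \in Ag g -> comp h x -> comp (g * h)%g (a *: x).
Proof. by rewrite /comp -mulgA; exact: gm_act. Qed.

Definition suspension : grmodType := GrModule suspension_dsum suspension_act.

End Suspension.

Hypothesis Agr : algebra_grading.

Fact regular_act (g h : G) (a : A) (x : A^o) :
  a \in Ag g -> x \in Ag h -> a *: x \in Ag (g * h)%g.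
Proof. by move=> ag xh; apply: (subvP (Agr.2 g h)); exact: memv_mul. Qed.

Definition gr_regular : grmodType :=
  @GrModule A^o (fun g x => x \in Ag g) Agr.1 regular_act.

Definition dual_comp (g : G) (f : dual A) : Prop :=
  forall (h : G) (x : A), h <> g^-1%g -> x \in Ag h -> dual_eval f x = 0.


Fact sumv_sup_seq (s : seq G) g :
  g \in s -> (Ag g <= \sum_(h <- s) Ag h)%VS.
Proof. by move=> gs; rewrite (big_rem g) //= addvSl. Qed.

Fact grading_finite : exists s : seq G,
  uniq s /\ (fullv = \sum_(g <- s | true) Ag g :> {vspace A})%VS.
Proof.
have [_ _ Vg _] := Agr.1.
have spanP (e : seq A) : exists s : seq G, {subset e <= (\sum_(g <- s) Ag g)%VS}.
  elim: e => [|x e [s IH]]; first by exists [::].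
  have [r [f [ur fV ->]]] := Vg x; exists (r ++ s) => y.
  rewrite big_cat inE => /predU1P[->|/IH ys] /=; last first.
    by apply: subvP ys; exact: addvSr.
  apply: (subvP (addvSl _ _)); rewrite big_seq; apply: memv_suml => g gr.
  by apply: subvP (fV g); exact: sumv_sup_seq.
have [r sub] := spanP (vbasis (fullv : {vspace A})).
exists (undup r); split; first exact: undup_uniq.
apply/eqP; rewrite eqEsubv subvf andbT -(span_basis (vbasisP fullv)).
apply/span_subvP => x /sub; apply: subvP.
rewrite big_seq; elim/big_ind: _ => [|U V|g gr]; first exact: sub0v.
- by move=> UV VV; rewrite subv_add UV.
- by apply: sumv_sup_seq; rewrite mem_undup.
Qed.

Fact dual_dsum : is_direct_sum dual_comp.
Proof.
have [_ _ _ Vf] := Agr.1.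
have [s [us sE]] := grading_finite.
pose p g : 'End(A) := linfun (sumv_pi_for sE g).
have pV g x : p g x \in Ag g by rewrite lfunE; exact: memv_sum_pi.
have pS x : \sum_(g <- s) p g x = x.
  under eq_bigr do rewrite lfunE /=.
  apply: sumv_pi_uniq_sum; first by rewrite filter_predT.
  by rewrite memvf.
have p0 g h x : x \in Ag h -> g \in s -> g != h -> p g x = 0.
  move=> xh gs gh.
  pose f j := (if j \in s then p j x else 0) - (if j == h then x else 0).
  have fV j : f j \in Ag j.
    rewrite rpredB //; first by case: ifP => _; rewrite ?mem0v.
    by case: eqP => [->|_]; rewrite ?mem0v.
  have [t [ut tE]] : exists t : seq G, uniq t /\ t =i h :: s.
    by exists (undup (h :: s)); split; [exact: undup_uniq | exact: mem_undup].
  have f0 : \sum_(j <- t) f j = 0.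
    have perm_s : perm_eq [seq i <- t | i \in s] s.
      apply: uniq_perm => //; first exact: filter_uniq.
      move=> j; rewrite mem_filter tE inE.
      by case: (j \in s); rewrite ?orbT.
    have s1 : \sum_(j <- t) (if j \in s then p j x else 0) = x.
      by rewrite -big_mkcond /= -big_filter (perm_big _ perm_s) pS.
    have s2 : \sum_(j <- t) (if j == h then x else 0) = x.
      rewrite -big_mkcond /= -big_filter (@filter_pred1_uniq _ _ h) ?big_seq1 //.
      by rewrite tE inE eqxx.
    by rewrite sumrB s1 s2 subrr.
  have /= := Vf _ f ut fV f0 g.
  rewrite tE inE gs orbT /f gs (negPf gh) subr0; exact.
split=> [g h x _ _|g f f' fg f'g h x hg xh|f|r f ur fV f0 g gr].
- exact: dual_eval0.
- by rewrite dual_evalB (fg h x) // (f'g h x) // subr0.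
- exists [seq g^-1%g | g <- s].
  exists (fun g => if g^-1%g \in s then (f \o p g^-1%g)%VF : dual A else 0).
  split; first by rewrite map_inj_uniq //; exact: invg_inj.
  + move=> g h x hg xh; case: ifP => gs; last exact: dual_eval0.
    rewrite /dual_eval comp_lfunE (p0 _ h) ?linear0 //.
    by apply/eqP => hE; apply: hg.
  + apply: dual_eqP => x; rewrite big_map.
    rewrite dual_eval_sum -{1}[x]pS dual_eval_sumr.
    by apply: eq_big_seq => g gs; rewrite invgK gs /dual_eval comp_lfunE.
- apply: dual_eqP => x.
  rewrite dual_eval0 -[x]pS dual_eval_sumr big1_seq //= => h hs.
  have [hg|/eqP hg] := altP (h =P g^-1%g); last exact: fV hg (pV h x).
  have := congr1 (fun u : dual A => dual_eval u (p h x)) f0.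
  rewrite dual_eval_sum dual_eval0 (bigD1_seq g) //= big1 ?addr0 // => j jg.
  apply: (fV j h) (pV h x) => hj; case/eqP: jg.
  by apply: invg_inj; rewrite -hj.
Qed.

Fact dual_act (g h : G) (a : A) (f : dual A) :
  a \in Ag g -> dual_comp h f -> dual_comp (g * h)%g (a *: f).
Proof.
move=> ag fh l x lgh xl.
rewrite -[LHS]/(dual_eval (dual_scale a f) x) dual_scaleE.
apply: (fh (l * g)%g); last by apply: (subvP (Agr.2 l g)); exact: memv_mul.
by move=> lg; apply: lgh; rewrite invgM -lg mulgK.
Qed.

Definition gr_dual : grmodType := GrModule dual_dsum dual_act.

Definition graded_frobenius (sigma : G) : Prop :=
  gr_isomorphic (suspension gr_regular sigma) gr_dual.

End Graded.

Section FormsAndIdeals.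
Variables (k : fieldType) (A : falgType k).

(* sesquilinear.nondegenerate only covers hermitian forms. *)
Definition nondegenerate_form (B : A -> A -> k) : Prop :=
  (forall x, (forall y, B x y = 0) -> x = 0) /\
  (forall y, (forall x, B x y = 0) -> y = 0).

Definition associative_form (B : A -> A -> k) : Prop :=
  forall x y z, B (x * y) z = B x (y * z).

Definition hyperplane (H : {vspace A}) : Prop :=
  (\dim H).+1 = \dim (fullv : {vspace A}).

(* As A is unital, every left ideal is a k-subspace. *)
Definition left_ideal (I : {vspace A}) : Prop := (fullv * I <= I)%VS.

(* I is the sum of the I :&: Ag g; directness is inherited from the grading. *)
Definition graded_subspace (G : groupType) (Ag : G -> {vspace A})
    (I : {vspace A}) : Prop :=
  forall x, x \in I -> exists (s : seq G) (f : G -> A),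
    [/\ uniq s, forall g, f g \in (I :&: Ag g)%VS & x = \sum_(g <- s) f g].

End FormsAndIdeals.

(* Main.v *)
Require Import Defs.
From HB Require Import structures.
From mathcomp Require Import all_boot all_order all_algebra all_field.
Set Implicit Arguments.
Unset Strict Implicit.
Unset Printing Implicit Defensive.
Import GRing.Theory.
Local Open Scope ring_scope.

(** All three conditions describe one linear functional [l : A -> k] that
    vanishes on every [Ag tau] with [tau <> sigma]:
    - an isomorphism [A(sigma) -> A^*] is determined by [l], the image of [1],
      since by [A]-linearity it sends [a] to [a l = (x |-> l (x a))];
    - an associative form is determined by [l x = B x 1], because
      [B x y = B (x y) 1], so that [B x y = l (x y)];
    - a hyperplane is the kernel of some [l], unique up to a nonzero factor.

    What the conditions require beyond homogeneity is that the radical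
    [{a | l (x a) = 0 for all x}] vanishes.  This radical is the kernel of
    [a |-> a l] ([orbit_map]), so its vanishing makes that map injective, and
    then bijective because [A] and [A^*] have the same finite dimension
    ([dual_orbit_bij]); it is also the right-hand half of non-degeneracy.
    Finally it is the largest left ideal contained in [lker l]
    ([radical_left_ideal], [radical_sub_lker], [sub_radical]).  It is graded as
    soon as [l] is homogeneous ([radical_graded]): for [x] of degree [h], only
    the component of [a] of degree [h^-1 sigma] contributes to [l (x a)].
    Hence it is enough to test [lker l] against graded left ideals.

    The degree bookkeeping rests on uniqueness of homogeneous decompositions
    ([dsum_homogeneous]).  It gives that [1] has trivial degree, and that the
    inverse of a degree-preserving bijection preserves degrees. *)

(** * Homogeneous components *)

Lemma dsum_homogeneous (I : eqType) (M : zmodType) (V : I -> M -> Prop)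
    (dV : is_direct_sum V) (s : seq I) (f : I -> M) (j : I) :
  uniq s -> (forall i, V i (f i)) -> V j (\sum_(i <- s) f i) ->
  forall i, i \in s -> i != j -> f i = 0.
Proof.
move=> us fV; set x := \sum_(i <- s) f i => xV i is_ ij.
(* The index [j] may or may not occur in [s], so the relation
   [\sum_(i <- s) f i - x = 0] is written over the duplicate-free [j :: s],
   with [f] cut off outside [s]; its coefficient at [i] is [f i]. *)
pose e l := if l == j then x else 0.
pose h l := (if l \in s then f l else 0) - e l.
have hV l : V l (h l).
  apply: (dsum_B dV); first by case: ifP => _; [exact: fV | exact: dsum_0 dV l].
  by rewrite /e; case: eqP => [->|_] //; exact: dsum_0 dV l.
pose t := undup (j :: s).
have ut : uniq t by exact: undup_uniq.
have tE l : (l \in t) = (l == j) || (l \in s) by rewrite mem_undup inE.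
have s1 : \sum_(l <- t) (if l \in s then f l else 0) = x.
  rewrite -big_mkcond /= -big_filter; apply: perm_big; apply: uniq_perm => //.
    exact: filter_uniq.
  by move=> l; rewrite mem_filter tE; case: (l \in s); rewrite ?orbT.
have s2 : \sum_(l <- t) e l = x.
  by rewrite /e -big_mkcond /= -big_filter filter_pred1_uniq ?big_seq1 // tE eqxx.
have h0 : \sum_(l <- t) h l = 0 by rewrite sumrB s1 s2 subrr.
have it : i \in t by rewrite tE is_ orbT.
by have := dsum_free dV ut hV h0 it; rewrite /h /e is_ (negPf ij) subr0.
Qed.

(** If [y] is homogeneous of degree [g], applying [f] to the decomposition of
    [f' y] decomposes [y]; its components outside degree [g] vanish, and so do
    those of [f' y] since [f] is injective. *)
Lemma gr_isomorphic_bij (G : groupType) (k : fieldType) (A : falgType k)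
    (Ag : G -> {vspace A}) (M N : grmodType Ag) (f : {linear M -> N}) :
  degree_preserving f -> bijective f -> gr_isomorphic M N.
Proof.
move=> fdeg [f' fK f'K].
pose f'L : {linear N -> M} :=
  HB.pack f' (GRing.isLinear.Build _ _ _ _ f' (can2_linear fK f'K)).
exists f, f'L; split=> // g y yg.
rewrite -[y]f'K in yg *; rewrite /= fK.
have [s [x [us xV xE]]] := dsum_gen (gm_dsum M) (f' y).
rewrite xE linear_sum in yg.
have fxV i : gm_comp i (f (x i)) by exact: fdeg.
have fx0 := dsum_homogeneous (gm_dsum N) us fxV yg.
have x0 i : i \in s -> i != g -> x i = 0.
  by move=> si ig; apply: (can_inj fK); rewrite fx0 // linear0.
rewrite xE; have [gs|gNs] := boolP (g \in s).
  rewrite (bigD1_seq g) //= big_seq_cond big1 ?addr0 // => i /andP[].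
  exact: x0.
rewrite big_seq big1; first exact: dsum_0 (gm_dsum M) g.
by move=> i si; apply: x0 => //; apply: contraNneq gNs => <-.
Qed.

(** Write [1 = \sum_g e g].  For [a] of degree [h], comparing components in
    [a = \sum_g a * e g] gives [a * e g = 0] for [g != 1]; summing over the
    components [a] of [1] gives [e g = 0]. *)
Lemma one_homogeneous (G : groupType) (k : fieldType) (A : falgType k)
    (Ag : G -> {vspace A}) : algebra_grading Ag -> 1 \in Ag 1%g.
Proof.
move=> [dA mA]; have [s [e [us eV e1]]] := dsum_gen dA 1.
have e0 i : i \in s -> i != 1%g -> e i = 0.
  move=> si i1; rewrite -[e i]mul1r.
  have [r [a [_ aV ->]]] := dsum_gen dA 1.
  rewrite mulr_suml big1 // => h _.
  (* [a h * e g] reindexed by its degree [j = h * g]. *)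
  pose c j := a h * e (h^-1 * j)%g.
  have cV j : c j \in Ag j.
    by rewrite -[j in Ag j](mulVKg h); apply: (subvP (mA _ _)); exact: memv_mul.
  have cE : \sum_(j <- [seq (h * g)%g | g <- s]) c j = a h.
    rewrite big_map -[RHS]mulr1 e1 mulr_sumr.
    by apply: eq_bigr => g _; rewrite /c mulKg.
  rewrite -[i in LHS](mulKg h); apply: (dsum_homogeneous dA (s := [seq (h * g)%g | g <- s]) _ cV (j := h)).
  - by rewrite map_inj_uniq //; exact: mulgI.
  - by rewrite cE; exact: aV.
  - exact: map_f.
  - by rewrite -[X in _ != X]mulg1 (inj_eq (@mulgI _ h)).
rewrite e1 big_seq rpred_sum // => i si.
have [->|i1] := eqVneq i 1%g; first exact: eV.
by rewrite e0 ?mem0v.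
Qed.

(** * Hyperplanes as kernels of functionals *)

Lemma scalar_hom (k : fieldType) (A : falgType k) (f : A -> k) :
  scalar f -> exists l : 'Hom(A, k^o), forall x, l x = f x.
Proof.
move=> fl; pose g : {linear A -> k^o} :=
  HB.pack (f : A -> k^o) (GRing.isLinear.Build _ _ _ _ (f : A -> k^o) fl).
by exists (linfun g) => x; rewrite lfunE.
Qed.

(** Used twice: to build a functional that cuts out a hyperplane, and, on the
    line of [x] itself, to see that [x = 0] as soon as every functional kills
    [x]. *)
Lemma vline_coord (k : fieldType) (A : falgType k) (v : A) :
  exists c : 'Hom(A, k^o), {in <[v]>%VS, forall x, x = c x *: v}.
Proof.
have [c cE] := scalar_hom (f := coord [tuple v] ord0) (linearP _).
exists c => x; rewrite -span_seq1 => /(coord_span (X := [tuple v])).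
by rewrite big_ord1 cE.
Qed.

(** The image of a nonzero functional is all of the one-dimensional [k]. *)
Lemma lker_hyperplane (k : fieldType) (A : falgType k) (l : 'Hom(A, k^o)) :
  l != 0 -> hyperplane (lker l).
Proof.
move=> l0; rewrite /hyperplane -(limg_ker_dim l fullv) capfv -addn1.
congr (_ + _)%N; apply/eqP; rewrite eqn_leq lt0n dimv_eq0.
rewrite (leq_trans (dimvS (subvf _))) ?dimvf ?andbT //.
apply: contraNneq l0 => li0; apply/eqP/lfunP => x.
by apply/eqP; rewrite zero_lfunE -memv0 -li0 memv_img ?memvf.
Qed.

(** A complement of [H] is a line; project onto it along [H] and take the
    coordinate. *)
Lemma hyperplane_lker (k : fieldType) (A : falgType k) (H : {vspace A}) :
  hyperplane H -> exists l : 'Hom(A, k^o), lker l = H.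
Proof.
move=> hH; have dC : \dim H^C = 1%N by rewrite dimv_compl -hH subSnn.
pose v := vpick H^C.
have v0 : v != 0 by rewrite vpick0 -dimv_eq0 dC.
have CE : (H^C = <[v]>)%VS.
  apply/eqP; rewrite eq_sym eqEdim -memvE memv_pick dim_vline v0.
  by rewrite dC.
have [c cE] := vline_coord v.
exists (c \o (\1 - projv H))%VF; apply/vspaceP => x.
rewrite memv_ker comp_lfunE add_lfunE opp_lfunE id_lfunE.
apply/eqP/idP => [c0|xH]; last by rewrite projv_id // subrr linear0.
have := memv_projC H x; rewrite CE => /cE.
rewrite c0 scale0r => /eqP; rewrite subr_eq0 => /eqP ->.
exact: memv_proj.
Qed.

(** * The radical of a functional *)

(** The map [a |-> a l] with values in ['Hom(A, k^o)], whose [k]-vector space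
    structure makes its kernel and its rank available; its kernel is the
    radical of [l]. *)
Definition orbit_map (k : fieldType) (A : falgType k) (l : 'Hom(A, k^o)) :
    'Hom(A, 'Hom(A, k^o)) :=
  linfun (fun a => (l \o amulr a)%VF).

Lemma orbit_mapE (k : fieldType) (A : falgType k) (l : 'Hom(A, k^o)) a x :
  orbit_map l a x = l (x * a).
Proof.
pose f a : 'Hom(A, k^o) := (l \o amulr a)%VF.
have fE b y : f b y = l (y * b) by rewrite comp_lfunE lfunE.
have fl : linear f.
  move=> c b b'; apply/lfunP => y.
  by rewrite add_lfunE scale_lfunE !fE mulrDr -scalerAr linearP.
pose fL : {linear A -> 'Hom(A, k^o)} :=
  HB.pack f (GRing.isLinear.Build _ _ _ _ f fl).
by rewrite -fE; congr (fun_of_lfun _ x); exact: (lfunE fL a).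
Qed.

Lemma radicalP (k : fieldType) (A : falgType k) (l : 'Hom(A, k^o)) a :
  reflect (forall x, l (x * a) = 0) (a \in lker (orbit_map l)).
Proof.
rewrite memv_ker; apply: (iffP eqP) => [a0 x|a0].
  by rewrite -orbit_mapE a0 zero_lfunE.
by apply/lfunP => x; rewrite orbit_mapE a0 zero_lfunE.
Qed.

(** An injective [k]-linear map from [A] to its dual is onto, both having the
    same finite dimension. *)
Lemma dual_orbit_bij (k : fieldType) (A : falgType k) (l : dual A) :
  lker (orbit_map l) = 0%VS -> bijective (fun a : A^o => a *: l).
Proof.
move=> ker0.
have lF : limg (orbit_map l) = fullv.
  apply/eqP; rewrite eqEdim subvf limg_dim_eq ?ker0 ?capv0 // !dimvf.
  by rewrite /dim /= muln1.
have FE (a : A^o) : a *: l = orbit_map l a.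
  by apply: dual_eqP => x; rewrite dual_scaleE -[RHS]/(orbit_map l a x) orbit_mapE.
exists (orbit_map l)^-1%VF => [a|g].
  by rewrite FE lker0_lfunK ?ker0.
by rewrite FE limg_lfunVK ?lF ?memvf.
Qed.

(** The next three lemmas say that the radical is the largest left ideal inside
    [lker l]. *)
Lemma radical_left_ideal (k : fieldType) (A : falgType k)
    (l : 'Hom(A, k^o)) : left_ideal (lker (orbit_map l)).
Proof.
apply/prodvP => y a _ /radicalP a0; apply/radicalP => x.
by rewrite mulrA a0.
Qed.

Lemma radical_sub_lker (k : fieldType) (A : falgType k)
    (l : 'Hom(A, k^o)) : (lker (orbit_map l) <= lker l)%VS.
Proof.
by apply/subvP => a /radicalP a0; rewrite memv_ker -[a]mul1r a0.
Qed.

Lemma sub_radical (k : fieldType) (A : falgType k) (l : 'Hom(A, k^o))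
    (I : {vspace A}) :
  left_ideal I -> (I <= lker l)%VS -> (I <= lker (orbit_map l))%VS.
Proof.
move=> II Il; apply/subvP => a aI; apply/radicalP => x; apply/eqP.
by rewrite -memv_ker (subvP Il) // (subvP II) // memv_mul ?memvf.
Qed.

(** Testing [a] in the radical against [x] of degree [h] isolates a single
    component: [l (x * a) = l (x * f g)] for [g = h^-1 sigma], all other
    products landing in degrees where [l] vanishes.  So every [f g] lies in the
    radical. *)
Lemma radical_graded (G : groupType) (k : fieldType) (A : falgType k)
    (Ag : G -> {vspace A}) (sigma : G) (l : 'Hom(A, k^o)) :
  algebra_grading Ag ->
  (forall tau : G, tau <> sigma -> (Ag tau <= lker l)%VS) ->
  graded_subspace Ag (lker (orbit_map l)).
Proof.
move=> [dA mA] lh a /radicalP a0.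
have [s [f [us fV aE]]] := dsum_gen dA a.
have l0 g h x y : x \in Ag g -> y \in Ag h -> (g * h)%g <> sigma -> l (x * y) = 0.
  move=> xg yh /lh/subvP gh; apply/eqP; rewrite -memv_ker gh //.
  by apply: (subvP (mA _ _)); exact: memv_mul.
have f0 g : g \in s -> f g \in lker (orbit_map l).
  move=> gs; apply/radicalP => x.
  have [r [b [_ bV ->]]] := dsum_gen dA x.
  rewrite mulr_suml linear_sum big1 // => h _.
  have [hg|/eqP hg] := eqVneq (h * g)%g sigma; last exact: l0 (bV h) (fV g) hg.
  have := a0 (b h); rewrite aE mulr_sumr linear_sum (bigD1_seq g) //=.
  rewrite big1 ?addr0 // => j jg; apply: l0 (bV h) (fV j) _ => hj.
  by case/eqP: jg; apply: (mulgI h); rewrite hj hg.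
(* Nothing is known about [f g] for [g] outside [s], so it is replaced by 0. *)
exists s, (fun g => if g \in s then f g else 0); split=> //.
  by move=> g; rewrite memv_cap; case: ifP => gs; rewrite ?mem0v ?f0 ?fV.
by rewrite aE; apply: eq_big_seq => g ->.
Qed.

(** * The three implications *)

Section Implications.
Variables (G : groupType) (k : fieldType) (A : falgType k).
Variables (Ag : G -> {vspace A}) (Agr : algebra_grading Ag) (sigma : G).

(** The form is [B x y = f y x], which is [l (x * y)] with [l] the image of
    [1].  Injectivity of [f] gives one half of non-degeneracy; surjectivity
    gives the other, since then every functional is some
    [x |-> l (x * y)]. *)
Lemma graded_frobenius_form : graded_frobenius Agr sigma ->
  exists B : {biscalar A},
    [/\ nondegenerate_form B,
        associative_form B &
        forall (tau mu : G) (r s : A), r \in Ag tau -> s \in Ag mu ->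
          (tau * mu)%g <> sigma -> B r s = 0].
Proof.
move=> [f [f' [fdeg _ fK f'K]]].
pose l : 'Hom(A, k^o) := f (1 : A^o).
have fE (y : A) x : dual_eval (f y) x = l (x * y).
  have -> : f y = (y : A) *: f (1 : A^o).
    by rewrite -linearZ /= /GRing.scale /= mulr1.
  by rewrite -[RHS]dual_scaleE.
have Bbi : bilinear_for *%R *%R (fun x y : A => l (x * y) : k).
  split=> [y c x x'|x c y y'] /=.
    by rewrite mulrDl -scalerAl linearP.
  by rewrite mulrDr -scalerAr linearP.
pose B : {biscalar A} :=
  HB.pack (fun x y : A => l (x * y) : k)
    (bilinear_isBilinear.Build _ _ _ _ _ _ (fun x y : A => l (x * y) : k) Bbi).
exists B; split.
- split=> [x x0|y y0].
    have [c cE] := vline_coord x.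
    rewrite [LHS]cE ?memv_line //.
    rewrite -[c x]/(dual_eval (c : dual A) x) -[c : dual A]f'K fE.
    by rewrite -[l _]/(B x (f' c)) x0 scale0r.
  apply: (can_inj fK); rewrite linear0; apply: dual_eqP => x.
  by rewrite fE dual_eval0 -[LHS]/(B x y).
- by move=> x y z; rewrite /B /= mulrA.
- move=> tau mu r s rt sm tm.
  rewrite -[LHS]/(l (r * s)) -fE.
  have /fdeg : @gm_comp _ _ _ _ (suspension (gr_regular Agr) sigma) (mu * sigma^-1)%g s.
    by rewrite /= mulgVK.
  apply; last exact: rt.
  by move=> tE; apply: tm; rewrite tE invgM invgK mulgVK.
Qed.

(** The hyperplane is the kernel of [x |-> B x 1].  It contains [Ag tau] for
    [tau <> sigma] because [1] has trivial degree. *)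
Lemma form_hyperplane :
  (exists B : {biscalar A},
    [/\ nondegenerate_form B,
        associative_form B &
        forall (tau mu : G) (r s : A), r \in Ag tau -> s \in Ag mu ->
          (tau * mu)%g <> sigma -> B r s = 0]) ->
  exists H : {vspace A},
    [/\ hyperplane H,
        forall tau : G, tau <> sigma -> (Ag tau <= H)%VS &
        forall I : {vspace A}, left_ideal I -> graded_subspace Ag I ->
          (I <= H)%VS -> I = 0%VS].
Proof.
move=> [B [[_ Bnd] Bas Bdeg]].
have [l lE] : exists l : 'Hom(A, k^o), forall x, l x = B x 1.
  by apply: scalar_hom => c x y; rewrite linearPl.
have BE x y : B x y = l (x * y) by rewrite lE Bas mulr1.
exists (lker l); split=> [|tau ts|I II _ IH].
- apply: lker_hyperplane; apply: contra_neq (oner_neq0 A) => l0.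
  by apply: Bnd => x; rewrite -lE l0 zero_lfunE.
- apply/subvP => x xt; rewrite memv_ker lE.
  by rewrite (Bdeg tau 1%g) ?mulg1 ?one_homogeneous.
- apply/eqP; rewrite -subv0; apply/subvP => a.
  move/(subvP (sub_radical II IH))/radicalP => a0; rewrite memv0.
  by apply/eqP/Bnd => x; rewrite BE.
Qed.

(** For [l] with kernel the hyperplane, the radical of [l] is a graded left ideal
    inside it, hence zero, so [a |-> a l] is bijective. *)
Lemma hyperplane_graded_frobenius :
  (exists H : {vspace A},
    [/\ hyperplane H,
        forall tau : G, tau <> sigma -> (Ag tau <= H)%VS &
        forall I : {vspace A}, left_ideal I -> graded_subspace Ag I ->
          (I <= H)%VS -> I = 0%VS]) ->
  graded_frobenius Agr sigma.
Proof.
move=> [H [/hyperplane_lker[l <-] lh Hid]].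
have rad0 : lker (orbit_map l) = 0%VS.
  apply: Hid; [exact: radical_left_ideal | exact: radical_graded lh |].
  exact: radical_sub_lker.
pose f (a : A^o) : dual A := (a : A) *: (l : dual A).
have fl : linear f.
  by move=> c a b; rewrite /f scalerDl scalerA.
pose fL : {linear suspension (gr_regular Agr) sigma -> gr_dual Agr} :=
  HB.pack f (GRing.isLinear.Build _ _ _ _ f fl).
apply: (gr_isomorphic_bij (f := fL)); last exact: dual_orbit_bij rad0.
move=> g a /= ag h x hg xh; rewrite dual_scaleE.
suff: x * a \in lker l by rewrite memv_ker => /eqP.
apply: subvP (lh (h * (g * sigma))%g _) _ _.
  move=> hs; apply: hg; apply: (mulIg (g * sigma)%g).
  by rewrite hs mulKg.
by apply: (subvP (Agr.2 _ _)); exact: memv_mul.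
Qed.

End Implications.

Theorem theorem4p1 (G : groupType) (k : fieldType) (A : falgType k)
    (Ag : G -> {vspace A}) (Agr : algebra_grading Ag) (sigma : G) :
  [<-> graded_frobenius Agr sigma;
       exists B : {biscalar A},
         [/\ nondegenerate_form B,
             associative_form B &
             forall (tau mu : G) (r s : A), r \in Ag tau -> s \in Ag mu ->
               (tau * mu)%g <> sigma -> B r s = 0];
       exists H : {vspace A},
         [/\ hyperplane H,
             forall tau : G, tau <> sigma -> (Ag tau <= H)%VS &
             forall I : {vspace A}, left_ideal I -> graded_subspace Ag I ->
               (I <= H)%VS -> I = 0%VS]].
Proof.
tfae; [exact: graded_frobenius_form | exact: form_hyperplane |].
exact: hyperplane_graded_frobenius.
Qed.
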